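(* Let $n$ be a positive integer, let $T$ be a finitely generated subsemigroup of $M_n(\mathbb{R}_{\max})$, and let $t$ be the rank of the free abelian subgroup of $(\mathbb{R},+)$ generated as a group by the finite entries of the matrices in $T$. Then the growth function of $T$ is bounded above by a polynomial of degree $tn^2$.
   Context: $\mathbb{N}$ is the set of positive integers. $\mathbb{R}_{\max}=\mathbb{R}\cup\{-\infty\}$ is the tropical semiring, with semiring addition $\max$ and semiring multiplication the usual addition (zero $-\infty$, one $0$). $M_n(\mathbb{R}_{\max})$ is the monoid of all $n\times n$ matrices over $\mathbb{R}_{\max}$ under (tropical) matrix multiplication. A finite entry is an entry different from $-\infty$. For a semigroup generated by a finite set $X$, its growth function with respect to $X$ is $f_X(k) = |\bigcup_{i=1}^k X^i|$ for $k\in\mathbb{N}$, where $X^i$ is the set of products of $i$ elements of $X$. It is bounded above by a polynomial of degree $m$ if there is $c_X>0$ such that $f_X(k)\le c_Xk^m$ for all $k\in\mathbb{N}$. This property does not depend on the choice of finite generating set, so one says that the growth function of the semigroup is bounded above by a polynomial of degree $m$ without reference to a generating set. *)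

(* Defs.v *)
From HB Require Import structures.
From mathcomp Require Import all_boot all_order all_algebra finmap.
From mathcomp Require Import all_classical all_reals.

Set Implicit Arguments.
Unset Strict Implicit.
Unset Printing Implicit Defensive.

Import Order.TTheory GRing.Theory Num.Theory.

Local Open Scope classical_set_scope.
Local Open Scope ring_scope.

(* [None] stands for -oo and [Some x] for the real number [x].  In ring_scope,
   [+] on [Rmax R] is the maximum and [*] is the usual addition, so that [*m]
   (and [*] on square matrices) is the tropical matrix product. *)
Definition Rmax (R : realType) : Type := option R.

HB.instance Definition _ (R : realType) := Choice.on (Rmax R).

Section Tropical.
Variable R : realType.
Implicit Types x y z : Rmax R.

Definition rmax_add x y : Rmax R :=
  match x, y with
  | None, _ => y
  | _, None => x
  | Some a, Some b => Some (Order.max a b)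
  end.

Definition rmax_mul x y : Rmax R :=
  match x, y with
  | Some a, Some b => Some (a + b)
  | _, _ => None
  end.

Definition rmax_zero : Rmax R := None.
Definition rmax_one : Rmax R := Some 0.

Lemma rmax_addA : associative rmax_add.
Proof. by move=> [a|] [b|] [c|] //=; rewrite maxA. Qed.

Lemma rmax_addC : commutative rmax_add.
Proof. by move=> [a|] [b|] //=; rewrite maxC. Qed.

Lemma rmax_add0 : left_id rmax_zero rmax_add.
Proof. by case. Qed.

Lemma rmax_mulA : associative rmax_mul.
Proof. by move=> [a|] [b|] [c|] //=; rewrite addrA. Qed.

Lemma rmax_mulC : commutative rmax_mul.
Proof. by move=> [a|] [b|] //=; rewrite addrC. Qed.

Lemma rmax_mul1 : left_id rmax_one rmax_mul.
Proof. by case=> [a|] //=; rewrite add0r. Qed.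

Lemma rmax_mulDl : left_distributive rmax_mul rmax_add.
Proof. by move=> [a|] [b|] [c|] //=; rewrite addr_maxl. Qed.

Lemma rmax_mul0 : left_zero rmax_zero rmax_mul.
Proof. by case. Qed.

Lemma rmax_one_neq0 : rmax_one != rmax_zero.
Proof. by []. Qed.

End Tropical.

HB.instance Definition _ (R : realType) :=
  GRing.isNmodule.Build (Rmax R)
    (@rmax_addA R) (@rmax_addC R) (@rmax_add0 R).

HB.instance Definition _ (R : realType) :=
  GRing.Nmodule_isComNzSemiRing.Build (Rmax R)
    (@rmax_mulA R) (@rmax_mulC R) (@rmax_mul1 R) (@rmax_mulDl R)
    (@rmax_mul0 R) (@rmax_one_neq0 R).

(* Semigroups are subsets of the multiplicative monoid of a semiring [S],
   used below with [S := 'M[Rmax R]_n]. *)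
Section Semigroups.
Variable S : pzSemiRingType.
Implicit Types X T : set S.

Definition semigroup_gen X : set S :=
  smallest (fun A : set S => forall a b, A a -> A b -> A (a * b)) X.

Definition finitely_generated T : Prop :=
  exists2 X : set S, finite_set X & T = semigroup_gen X.

Definition products X (i : nat) : set S :=
  [set \prod_(a <- w) a | w in [set w : seq S |
     size w = i /\ forall a, a \in w -> X a]].

(* [fset_set] is only meaningful on finite sets; the union below is finite
   as soon as [X] is. *)
Definition growth X (k : nat) : nat :=
  #|` fset_set (\bigcup_(i in [set i | (1 <= i <= k)%N]) products X i)|.

Definition poly_growth_wrt (R : realType) X (m : nat) : Prop :=
  exists2 c : R, 0 < c &
    forall k : nat, (0 < k)%N -> (growth X k)%:R <= c * k%:R ^+ m.

(* Boundedness is independent of the finite generating set, so it is required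
   of all of them; meant for finitely generated [T], where one exists. *)
Definition poly_growth (R : realType) T (m : nat) : Prop :=
  forall X, finite_set X -> T = semigroup_gen X -> poly_growth_wrt R X m.

End Semigroups.

Section FreeAbelian.
Variable V : zmodType.
Implicit Types G : set V.

Definition subgroup_gen (E : set V) : set V :=
  smallest (fun A : set V =>
    A 0 /\ forall x y, A x -> A y -> A (x - y)) E.

Definition zbasis G (t : nat) (e : 'I_t -> V) : Prop :=
  (forall a : 'I_t -> int, \sum_(i < t) e i *~ a i = 0 -> forall i, a i = 0) /\
  G = [set \sum_(i < t) e i *~ a i | a in [set: 'I_t -> int]].

Definition free_abelian_of_rank G (t : nat) : Prop :=
  exists e : 'I_t -> V, zbasis G e.

End FreeAbelian.

Definition finite_entries (R : realType) (n : nat) (T : set 'M[Rmax R]_n) :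
    set R :=
  [set x | exists2 A, T A & exists i j, A i j = Some x].

(* Main.v *)
Require Import Defs.
From mathcomp Require Import all_boot all_order all_algebra.
From mathcomp Require Import finmap.
From mathcomp Require Import all_classical all_reals.
From mathcomp Require Import zify.

(** The idea is to count lattice points.  Let [e] be a basis of the group
    generated by the finite entries, so that every finite entry of a generator
    is an integer combination of the [t] vectors of [e].  The generators are
    finitely many, hence some [N] bounds all the coordinates that occur in them.
    A finite entry of a product of [i <= k] generators is a maximum of sums of
    [i] finite entries of generators; a maximum is one of its arguments, so the
    coordinates of the entry are at most [k * N] in absolute value
    ([entries_in_box_prod]).  Each entry is therefore -oo or one of at most
    [(2 k N + 1) ^ t] real numbers, and there are at most
    [((2 k N + 1) ^ t + 1) ^ (n ^ 2)] such matrices ([growth_le_box]), which is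
    [O(k ^ (t n ^ 2))]. *)

Import Order.TTheory GRing.Theory Num.Theory.

Section BoxCounting.
Local Set Implicit Arguments.
Local Unset Strict Implicit.
Local Unset Printing Implicit Defensive.
Local Open Scope classical_set_scope.

Lemma finite_uniform_bound (I : Type) (X : set I) (P : nat -> I -> Prop) :
  finite_set X ->
  (forall M N x, (M <= N)%N -> P M x -> P N x) ->
  (forall x, X x -> exists N, P N x) ->
  exists N, forall x, X x -> P N x.
Proof.
move=> finX Pmono exP.
have /choice[f fP] : forall x, exists N, X x -> P N x.
  move=> x; have [Xx|nXx] := pselect (X x); last by exists 0%N.
  by have [N PN] := exP x Xx; exists N.
have /finite_seqP[s fXE] : finite_set (f @` X) by exact: finite_image.
exists (\max_(m <- s) m)%N => x Xx; apply: Pmono (fP x Xx).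
apply: (@leq_bigmax_seq _ _ xpredT id) => //.
have : [set` s] (f x) by rewrite -fXE; exists x.
by [].
Qed.

Lemma card_fset_set_le (T : choiceType) (P : finType) (d : P -> T)
    (A : set T) :
  A `<=` range d -> (#|` fset_set A| <= #|P|)%N.
Proof.
move=> Ad.
have finA : finite_set A by apply: sub_finite_set Ad _; exact: finite_image.
have sub : {subset fset_set A <= [seq d p | p <- enum P]}.
  move=> x; rewrite in_fset_set// inE => /Ad[p _ <-].
  by rewrite map_f// mem_enum.
rewrite cardE -(size_map d).
exact: uniq_leq_size (fset_uniq _) sub.
Qed.

Lemma leq_expn2r (m n k : nat) : (m <= n -> m ^ k <= n ^ k)%N.
Proof. by case: k => // k; rewrite leq_exp2r. Qed.

(** Both additive constants are absorbed into their neighbour: [2 k N + 1] is at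
    most [(2 N + 1) k], and adding 1 to a [t]-th power at most doubles it.  The
    exponent of [k] is then exactly [t * n ^ 2], also when [t = 0]. *)
Lemma box_card_le (N n t k : nat) : (0 < k)%N ->
  (((2 * (k * N)).+1 ^ t).+1 ^ (n * n) <=
   (2 * (2 * N).+1 ^ t) ^ (n * n) * k ^ (t * n ^ 2))%N.
Proof.
move=> k0; rewrite mulnn expnM -expnMn leq_expn2r//.
have le1 : ((2 * (k * N)).+1 ^ t <= ((2 * N).+1 * k) ^ t)%N.
  by apply: leq_expn2r; nia.
rewrite -mulnA -expnMn [leqRHS]mul2n -addnn -[leqLHS]addn1 leq_add//.
by rewrite expn_gt0 muln_gt0 k0.
Qed.


Local Open Scope ring_scope.

Lemma Rmax_SomeD (R : realType) (a b : R) :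
  (Some a : Rmax R) + Some b = Some (Order.max a b).
Proof. by []. Qed.

Lemma Rmax_SomeM (R : realType) (a b : R) :
  (Some a : Rmax R) * Some b = Some (a + b).
Proof. by []. Qed.

Variables (R : realType) (t : nat) (e : 'I_t -> R).

Definition in_box (N : nat) (x : Rmax R) : Prop :=
  x = None \/ exists2 a : 'I_t -> int,
    forall i, `|a i| <= N%:Z & x = Some (\sum_(i < t) e i *~ a i).

Lemma in_box_widen M N x : (M <= N)%N -> in_box M x -> in_box N x.
Proof.
move=> MN [->|[a aM ->]]; [by left|right; exists a => // i].
by rewrite (le_trans (aM i))// lez_nat.
Qed.

Lemma in_box0 N : in_box N 0.
Proof. by left. Qed.

Lemma in_box1 N : in_box N 1.
Proof.
right; exists (fun=> 0) => [i|]; first by rewrite normr0.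
by rewrite big1// => i _; rewrite mulr0z.
Qed.

Lemma in_boxD N x y : in_box N x -> in_box N y -> in_box N (x + y).
Proof.
move=> [->|[a aN ->]] //; move=> [->|[b bN ->]]; first by right; exists a.
right; rewrite Rmax_SomeD /Order.max.
by case: ifP => _; [exists b|exists a].
Qed.

Lemma in_boxM M N x y : in_box M x -> in_box N y -> in_box (M + N) (x * y).
Proof.
move=> [->|[a aM ->]]; first by left.
move=> [->|[b bN ->]]; first by left.
right; exists (fun i => a i + b i) => [i|].
  by rewrite (le_trans (ler_normD _ _))// PoszD lerD.
rewrite Rmax_SomeM -big_split/=; congr Some.
by apply: eq_bigr => i _; rewrite mulrzDr_tmp.
Qed.

Variable n : nat.

Definition entries_in_box (N : nat) (A : 'M[Rmax R]_n) : Prop :=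
  forall i j, in_box N (A i j).

(** The size of the box grows additively, and not exponentially, with the
    length of the product: the sum over intermediate indices in a matrix product
    is a maximum, which stays in the box. *)
Lemma entries_in_box_prod N (w : seq 'M[Rmax R]_n) :
  (forall A, A \in w -> entries_in_box N A) ->
  entries_in_box (size w * N) (\prod_(A <- w) A).
Proof.
elim: w => [|A w IHw] wN i j.
  rewrite big_nil mxE; case: (i == j); [exact: in_box1|exact: in_box0].
rewrite big_cons mxE; apply: (big_ind (in_box _)) => [||l _].
- exact: in_box0.
- exact: in_boxD.
- apply: in_boxM; first by apply: wN; rewrite mem_head.
  by apply: IHw => B Bw; apply: wN; rewrite inE Bw orbT.
Qed.

Definition box_code (N : nat) : finType :=
  'M[option {ffun 'I_t -> 'I_(2 * N).+1}]_n.

(** Coordinates in [-N, N] are shifted by [N] to be stored as ordinals. *)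
Definition box_decode (N : nat) (p : box_code N) : 'M[Rmax R]_n :=
  map_mx (omap (fun c : {ffun 'I_t -> 'I_(2 * N).+1} =>
    \sum_(i < t) e i *~ ((c i : nat)%:Z - N%:Z))) p.

Lemma entries_in_box_decode N A :
  entries_in_box N A -> range (@box_decode N) A.
Proof.
move=> AN.
have /choice[c cE] : forall ij : 'I_n * 'I_n,
    exists c : option {ffun 'I_t -> 'I_(2 * N).+1},
      A ij.1 ij.2 = omap (fun c : {ffun 'I_t -> 'I_(2 * N).+1} =>
        \sum_(i < t) e i *~ ((c i : nat)%:Z - N%:Z)) c.
  move=> [i j]; case: (AN i j) => [->|[a aN ->]]; first by exists None.
  exists (Some [ffun l => inord (absz (a l + N%:Z))]) => /=.
  congr Some; apply: eq_bigr => l _; congr (_ *~ _).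
  have := aN l; rewrite ler_norml ffunE => /andP[a_ge a_le].
  by rewrite inordK; lia.
exists (\matrix_(i, j) c (i, j)) => //.
by apply/matrixP => i j; rewrite !mxE -(cE (i, j)).
Qed.

Lemma growth_le_box (X : set 'M[Rmax R]_n) (N k : nat) :
  (forall A, X A -> entries_in_box N A) ->
  (growth X k <= ((2 * (k * N)).+1 ^ t).+1 ^ (n * n))%N.
Proof.
move=> XN.
have -> : (((2 * (k * N)).+1 ^ t).+1 ^ (n * n) = #|box_code (k * N)|)%N.
  by rewrite card_mx card_option card_ffun !card_ord.
apply: (card_fset_set_le (d := @box_decode (k * N))) => _ [i ik [w [wi wX] <-]].
apply: entries_in_box_decode => r c.
apply: in_box_widen (entries_in_box_prod (N := N) _ r c).
  by move: ik => /= /andP[_ ik]; rewrite wi leq_mul2r ik orbT.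
by move=> A Aw; apply: XN; exact: wX.
Qed.

(** Finitely many entries lying in the group spanned by [e] have bounded
    coordinates; the maxima are taken over coordinates, over entries and over
    matrices. *)
Lemma entries_in_box_bound (X : set 'M[Rmax R]_n) :
  finite_set X ->
  (forall A i j x, X A -> A i j = Some x ->
    exists a : 'I_t -> int, x = \sum_(l < t) e l *~ a l) ->
  exists N, forall A, X A -> entries_in_box N A.
Proof.
move=> finX Xe; apply: finite_uniform_bound => // [M N A MN AM i j|A XA].
  exact: in_box_widen MN (AM i j).
have [|M N ij MN|[i j] _|N AN] :=
  @finite_uniform_bound ('I_n * 'I_n)%type setT
    (fun N ij => in_box N (A ij.1 ij.2)).
- exact: finite_finset.
- exact: in_box_widen.
- case Aij : (A i j) => [x|]; last by exists 0%N; left.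
  have [a xE] := Xe _ _ _ _ XA Aij.
  exists (\max_(l < t) `|a l|)%N; right; exists a => [l|]; last by rewrite -xE.
  by rewrite -abszE lez_nat; apply: (leq_bigmax (F := fun l => absz (a l))).
- by exists N => i j; exact: (AN (i, j)).
Qed.

End BoxCounting.

Theorem corollary6p3 (R : realType) (n : nat) (T : set 'M[Rmax R]_n) (t : nat) :
  (0 < n)%N ->
  finitely_generated T ->
  free_abelian_of_rank (subgroup_gen (finite_entries T)) t ->
  poly_growth R T (t * n ^ 2)%N.
Proof.
move=> _ _ [e [_ GE]] X finX TX.
have [|N XN] := @entries_in_box_bound R t e n X finX.
  move=> A i j x XA Aij.
  have : subgroup_gen (finite_entries T) x.
    apply: sub_gen_smallest; exists A; last by exists i, j.
    by rewrite TX; exact: sub_gen_smallest XA.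
  by rewrite GE => -[a _ <-]; exists a.
exists (((2 * (2 * N).+1 ^ t) ^ (n * n))%N%:R)%R.
  by rewrite ltr0n !expn_gt0 muln_gt0 expn_gt0.
move=> k k0; rewrite -natrX -natrM ler_nat.
exact: leq_trans (@growth_le_box R t e n X N k XN) (box_card_le _ _ _ k0).
Qed.
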